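(* Let $n\ge 2$ be an integer and let $(X,d)$ be a complete metric space with $|X|\geq n$. Let $T\colon X\to X$ be a continuous and asymptotically regular generalized $n$-point Kannan-type mapping with coefficient $\lambda\in[0,\infty)$, i.e. $S(Tx_1,\dots,Tx_n)\le\lambda\sum_{i=1}^n d(x_i,Tx_i)$ for all pairwise distinct points $x_1,\dots,x_n\in X$. Then $T$ has a fixed point in $X$. Moreover, $T$ can admit at most $n-1$ fixed points.
   Context: $|X|$ denotes the cardinality of $X$. For points $x_1,\dots,x_n$ of a metric space $(X,d)$ put $S(x_1,\dots,x_n)=\sum_{1\le i<j\le n} d(x_i,x_j)$. A mapping $T\colon X\to X$ is asymptotically regular if $\lim_{k\to\infty} d(T^{k}x,T^{k+1}x)=0$ for all $x\in X$. *)

(* Defs.v *)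
From HB Require Import structures.
From mathcomp Require Import all_boot all_order all_algebra.
From mathcomp Require Import all_classical all_reals all_analysis.

Set Implicit Arguments.
Unset Strict Implicit.
Unset Printing Implicit Defensive.

Import Order.TTheory GRing.Theory Num.Theory.
Import numFieldNormedType.Exports.

Local Open Scope classical_set_scope.
Local Open Scope ring_scope.

(* [Complete] also provides a distinguished point, which loses nothing as
   long as the space is required to be nonempty. *)
#[short(type="completeMetricType")]
HB.structure Definition CompleteMetric (R : numDomainType) :=
  {X of Metric R X & Complete X}.

Definition sum_dist (R : realType) (X : metricType R) (n : nat)
    (x : 'I_n -> X) : R :=
  \sum_(i < n) \sum_(j < n | (i < j)%N) mdist (x i) (x j).

Definition n_point_kannan_type (R : realType) (X : metricType R)
    (n : nat) (lambda : R) (T : X -> X) : Prop :=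
  forall x : 'I_n -> X, injective x ->
    sum_dist (T \o x) <= lambda * \sum_(i < n) mdist (x i) (T (x i)).

Definition asymptotically_regular (R : realType) (X : metricType R)
    (T : X -> X) : Prop :=
  forall x : X, mdist (iter k T x) (iter k.+1 T x) @[k --> \oo] --> (0 : R).

(* Main.v *)
(** In any orbit with pairwise distinct iterates, apply the Kannan inequality to
    [T^p x], [T^q x] and [n - 2] further iterates of index above [q]: it bounds
    [d(T^(p+1) x, T^(q+1) x)] by [lambda] times a sum of [n] consecutive
    distances, all small by asymptotic regularity.  So the orbit is Cauchy and
    its limit is fixed by continuity.  An orbit with a repetition is eventually
    periodic, and asymptotic regularity makes the period one.  At [n] distinct
    fixed points the inequality would read [S <= 0]. *)

Require Import Defs.
From mathcomp Require Import all_boot all_order all_algebra.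
From mathcomp Require Import all_classical all_reals all_analysis.
From mathcomp Require Import zify.

Set Implicit Arguments.
Unset Strict Implicit.
Unset Printing Implicit Defensive.

Import Order.TTheory GRing.Theory Num.Theory.
Import numFieldNormedType.Exports.

Local Open Scope classical_set_scope.
Local Open Scope card_scope.
Local Open Scope ring_scope.

Lemma mdist_le_sum_dist (R : realType) (X : metricType R) (n : nat)
    (x : 'I_n -> X) (i j : 'I_n) :
  (i < j)%N -> mdist (x i) (x j) <= sum_dist x.
Proof.
move=> ij; rewrite /sum_dist (bigD1 i)//= (bigD1 j)//= -addrA lerDl.
apply: addr_ge0; apply: sumr_ge0 => k _; first exact: mdist_ge0.
by apply: sumr_ge0 => l _; exact: mdist_ge0.
Qed.

(** An infinite set contains a copy of the naturals, and a finite one is compared by its size. This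
    turns the failure of an upper bound into a supply of distinct points. *)
Lemma card_le_or_gt_II (T : Type) (A : set T) (n : nat) :
  A #<= `I_n \/ `I_n.+1 #<= A.
Proof.
have [/finite_setP[m Am]|/infiniteP NA] := pselect (finite_set A); last first.
  by right; apply: card_le_trans NA; exact: card_leT.
rewrite (card_le_eql Am) (card_le_eqr Am) !card_le_II.
by case: leqP; [left|right].
Qed.

Lemma injective_of_card_le (T : Type) (A : set T) (n : nat) :
  `I_n #<= A -> exists2 x : 'I_n -> T, injective x & forall i, A (x i).
Proof.
move=> /card_leP[f].
have In (i : 'I_n) : val i \in `I_n by exact/mem_set/ltn_ord.
exists (fun i => set_val (f (SigSub (In i)))) => [i j /val_inj fij|i].
  have /(congr1 val) := 'inj_f (in_setT _) (in_setT _) fij.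
  by move=> ?; apply: val_inj.
exact: set_valP.
Qed.

Lemma card_fixed_points (R : realType) (X : metricType R) (n : nat)
    (lambda : R) (T : X -> X) :
  (2 <= n)%N -> n_point_kannan_type n lambda T ->
  [set x | T x = x] #<= `I_(n - 1).
Proof.
case: n => [|[|n]]// _ kannan; rewrite subn1/=.
have [//|] := card_le_or_gt_II [set x | T x = x] n.+1.
move=> /injective_of_card_le[x x_inj fixx].
have := kannan x x_inj; rewrite big1 => [|i _]; last by rewrite fixx mdistxx.
rewrite mulr0 leNgt => /negP[].
(* Since there are at least two points, the first and the last differ, and their positive distance
   is a term of the sum. *)
have lt01 : (@ord0 n.+1 < @ord_max n.+1)%N by [].
apply: lt_le_trans (mdist_le_sum_dist _ lt01).
by rewrite mdist_gt0 /= !fixx (inj_eq x_inj).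
Qed.

(** With [y] the repeated iterate, [T] has period [q - p] along the orbit of [y], so the consecutive
    distance at every multiple of [q - p] equals that between [y] and [T y]; as these distances tend
    to 0, it vanishes. *)
Lemma fixed_point_of_repeated_iterate (R : realType) (X : metricType R)
    (T : X -> X) (x : X) (p q : nat) :
  asymptotically_regular T -> (p < q)%N -> iter p T x = iter q T x ->
  T (iter p T x) = iter p T x.
Proof.
move=> reg pq eqpq.
set y := iter p T x.
have per m : iter (m * (q - p)) T y = y.
  elim: m => [|m IH]; first by rewrite mul0n.
  by rewrite mulSn iterD IH /y -iterD subnK ?(ltnW pq).
apply/esym/mdist_positivity/eqP; rewrite eq_le mdist_ge0 andbT.
apply/ler_addgt0Pl => e e0; rewrite addr0.
have /cvgrPdist_lt/(_ e e0)[N _ HN] := reg y.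
(* A multiple of the period that lies beyond the threshold [N]. *)
have /HN : (N <= N * (q - p))%N by rewrite leq_pmulr// subn_gt0.
by rewrite /= per sub0r normrN => /(le_lt_trans (ler_norm _))/ltW.
Qed.

Lemma injective_orbit_mdist_le (R : realType) (X : metricType R) (n : nat)
    (lambda e : R) (T : X -> X) (x : X) (p q : nat) :
  n_point_kannan_type n.+2 lambda T -> 0 <= lambda ->
  injective (fun k => iter k T x) ->
  (forall k, (p <= k)%N -> mdist (iter k T x) (iter k.+1 T x) <= e) ->
  (p < q)%N ->
  mdist (iter p.+1 T x) (iter q.+1 T x) <= lambda * (e *+ n.+2).
Proof.
move=> kannan lambda0 orb_inj small pq.
(* The [n + 2] indices [p, q, q + 1, ..., q + n]. *)
pose idx (i : 'I_n.+2) := if val i is m.+1 then (q + m)%N else p.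
have idx_ge i : (p <= idx i)%N.
  by rewrite /idx; case: (val i) => // m; rewrite ltnW// ltn_addr.
have idx_inj : injective idx.
  move=> [[|i] Hi] [[|j] Hj]; rewrite /idx/= => eqij; apply: val_inj;
    rewrite /=; lia.
pose y i := iter (idx i) T x.
have y_inj : injective y by move=> i j /orb_inj/idx_inj.
have lt01 : (@ord0 n.+1 < lift ord0 (@ord0 n))%N by [].
have idx1 : idx (lift ord0 ord0) = q by exact: addn0.
have -> : mdist (iter p.+1 T x) (iter q.+1 T x)
    = mdist ((T \o y) ord0) ((T \o y) (lift ord0 ord0)).
  by rewrite /= /y idx1.
apply: (le_trans (mdist_le_sum_dist _ lt01)).
apply: (le_trans (kannan y y_inj)); rewrite ler_wpM2l//.
apply: (@le_trans _ _ (\sum_(i < n.+2) e)); last by rewrite sumr_const card_ord.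
by apply: ler_sum => i _; rewrite /y -iterS small.
Qed.

Lemma cauchy_injective_orbit (R : realType) (X : metricType R) (n : nat)
    (lambda : R) (T : X -> X) (x : X) :
  n_point_kannan_type n.+2 lambda T -> 0 <= lambda ->
  asymptotically_regular T -> injective (fun k => iter k T x) ->
  cauchy (iter k T x @[k --> \oo]).
Proof.
move=> kannan lambda0 reg orb_inj; apply: cauchy_exP => eps eps0.
(* Using [lambda + 1] instead of [lambda] keeps the denominator positive when [lambda] is 0 and
   makes the final bound strictly less than [eps]. *)
pose e := eps / ((lambda + 1) * n.+2%:R).
have e0 : 0 < e by rewrite divr_gt0// mulr_gt0// ltr_wpDl.
have /cvgrPdist_lt/(_ e e0)[p _ Hp] := reg x.
exists (iter p.+1 T x); exists p.+1 => // k /= pk.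
rewrite ballEmdist/=.
(* The centre of the ball is treated apart, because the distance estimate needs two different
   indices. *)
have [->|ltpk] := eqVneq k p.+1; first by rewrite mdistxx.
have -> : k = k.-1.+1 by lia.
have pk1 : (p < k.-1)%N by lia.
apply: le_lt_trans (injective_orbit_mdist_le kannan lambda0 orb_inj _ pk1) _.
  move=> j /Hp /=; rewrite sub0r normrN => /(le_lt_trans (ler_norm _)).
  exact: ltW.
rewrite -mulr_natr mulrCA /e.
rewrite -[ltRHS](@divfK _ ((lambda + 1) * n.+2%:R)).
  by rewrite ltr_pM2l// ltr_pM2r// ltrDl.
by rewrite gt_eqF// mulr_gt0// ltr_wpDl.
Qed.

(** The shifted orbit tends to [T z] by continuity and to [z] as a tail of the orbit; limits are
    unique in a metric space. *)
Lemma fixed_point_of_cvg_orbit (R : realType) (X : metricType R)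
    (T : X -> X) (x z : X) :
  continuous T -> iter k T x @[k --> \oo] --> z -> T z = z.
Proof.
move=> Tcont xz.
have Txz : iter k.+1 T x @[k --> \oo] --> T z.
  exact: (cvg_comp _ _ xz (Tcont z)).
apply: (cvg_unique (@metric_hausdorff _ X)) Txz _.
exact: (cvg_comp _ _ (cvg_addnl 1) xz).
Qed.

Theorem corollary4p5 (R : realType) (n : nat) (hn : (2 <= n)%N)
    (X : completeMetricType R) (hX : `I_n #<= [set: X])
    (T : X -> X) (lambda : R) (hlambda : 0 <= lambda)
    (hcont : continuous T) (hreg : asymptotically_regular T)
    (hkannan : n_point_kannan_type n lambda T) :
  (exists x : X, T x = x) /\ [set x : X | T x = x] #<= `I_(n - 1).
Proof.
split; last exact: card_fixed_points hkannan.
case: n hn hX hkannan => [|[|n]]// _ _ hkannan.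
pose x : X := point.
have [orb_inj|] := pselect (injective (fun k => iter k T x)).
  have /cauchy_cvg orb_cvg :=
    cauchy_injective_orbit hkannan hlambda hreg orb_inj.
  exists (lim (iter k T x @[k --> \oo])).
  exact: fixed_point_of_cvg_orbit orb_cvg.
move=> /existsNP[p /existsNP[q /not_implyP[eqpq /eqP]]].
(* The iterate with the smaller of the two indices is the fixed point. *)
rewrite neq_ltn => /orP[] lt_pq.
  by exists (iter p T x); exact: fixed_point_of_repeated_iterate lt_pq eqpq.
exists (iter q T x); exact: fixed_point_of_repeated_iterate lt_pq (esym eqpq).
Qed.
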